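(* For every Stone space $X$, the poset $\mathcal{IR}(X)$ of interior relations on $X$, ordered by inclusion, is a bounded join-semilattice. In general it is neither distributive nor a lattice; that is, there exists a Stone space $X$ such that $\mathcal{IR}(X)$ is neither a distributive join-semilattice nor a lattice.
   Context: A Stone space is a compact Hausdorff zero-dimensional space. A binary relation $R$ on a Stone space $X$ is continuous if $R[x]=\{y : x\mathrel{R}y\}$ is closed for each $x\in X$ and $R^{-1}[U]=\{x : x \mathrel{R} y \text{ for some } y\in U\}$ is clopen for each clopen $U\subseteq X$. A continuous relation $R$ is an interior relation if, in addition, $R[U]=\{y : x\mathrel{R}y\text{ for some }x\in U\}$ is clopen for each clopen $U\subseteq X$. $\mathcal{IR}(X)$ is the set of interior relations on $X$, ordered by inclusion. A bounded join-semilattice is a poset with least and greatest elements and all binary joins. A join-semilattice $L$ is distributive if for all $a,b,c\in L$, $a\le b\vee c$ implies that there are $b'\le b$ and $c'\le c$ with $a=b'\vee c'$. *)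

(* Defs.v *)
From HB Require Import structures.
From mathcomp Require Import all_boot all_order.
From mathcomp Require Import boolp classical_sets topology.

Set Implicit Arguments.
Unset Strict Implicit.
Unset Printing Implicit Defensive.

Local Open Scope classical_set_scope.

(* The library predicate [zero_dimensional] only asks that distinct points be
   separated by a clopen set; the usual notion, used here, is the existence of
   a basis of clopen sets. *)
Definition stone_space (X : topologicalType) : Prop :=
  [/\ compact [set: X], hausdorff_space X & basis [set U : set X | clopen U]].

Section Relations.
Variable X : Type.
Implicit Types (R : set (X * X)) (U : set X).

Definition rel_at R (x : X) : set X := [set y | R (x, y)].

Definition rel_preimage R U : set X := [set x | exists2 y, U y & R (x, y)].

Definition rel_image R U : set X := [set y | exists2 x, U x & R (x, y)].

End Relations.

Definition continuous_relation (X : topologicalType) (R : set (X * X)) : Prop :=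
  (forall x, closed (rel_at R x)) /\
  (forall U : set X, clopen U -> clopen (rel_preimage R U)).

Definition interior_relation (X : topologicalType) (R : set (X * X)) : Prop :=
  continuous_relation R /\
  (forall U : set X, clopen U -> clopen (rel_image R U)).

Definition IR (X : topologicalType) : Type :=
  set_type [set R : set (X * X) | interior_relation R].

HB.instance Definition _ (X : topologicalType) := SubChoice.on (IR X).
HB.instance Definition _ (X : topologicalType) :=
  [SubChoice_isSubPOrder of IR X by <: with set_display].

Lemma leIR (X : topologicalType) (R S : IR X) :
  (R <= S)%O = (val R `<=` val S) :> Prop.
Proof. by rewrite -subsetEset Order.le_val. Qed.

Section Posets.
Variables (d : Order.disp_t) (P : porderType d).

(* [supremums A] (resp. [infimums A]) is the set of all least upper (resp.
   greatest lower) bounds of A; it is empty or a singleton. *)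
Definition is_join (a b j : P) : Prop := supremums [set a; b] j.

Definition is_meet (a b m : P) : Prop := infimums [set a; b] m.

Definition has_joins : Prop := forall a b : P, exists j, is_join a b j.

Definition has_meets : Prop := forall a b : P, exists m, is_meet a b m.

Definition bounded_join_semilattice : Prop :=
  [/\ exists bot : P, forall a : P, (bot <= a)%O,
      exists top : P, forall a : P, (a <= top)%O
    & has_joins].

(* Meaningful when [has_joins] holds: j is then the join of b and c. *)
Definition join_distributive : Prop :=
  forall a b c j : P, is_join b c j -> (a <= j)%O ->
    exists b' c' : P, [/\ (b' <= b)%O, (c' <= c)%O & is_join b' c' a].

Definition is_lattice : Prop := has_joins /\ has_meets.

End Posets.

Arguments bounded_join_semilattice {d} P.
Arguments join_distributive {d} P.
Arguments is_lattice {d} P.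

(* Main.v *)
Require Import Defs.
From mathcomp Require Import all_boot all_order.
From mathcomp Require Import boolp classical_sets topology.

(** Clopen boxes are interior relations, and so are finite unions of interior
    relations, hence the bounds and the joins.

    For the negative part, take the one-point compactification of the discrete
    space [bool * bool * nat], whose point at infinity is [None].  The
    involution [flip b] moves exactly the points [(b, j, n)], so infinity is in
    the closure both of its moved points and of its fixed points.  The domain
    of an interior relation contained in the diagonal and in the graph of
    [flip b] is a clopen set of fixed points of [flip b], so it avoids
    infinity.
    - The diagonal is contained in the union of the graphs of [flip true] and
      [flip false], but it cannot be split accordingly: neither part would
      contain (infinity, infinity).
    - A meet of the diagonal and the graph of [flip true] would have a clopen
      domain avoiding infinity but containing every isolated fixed point of
      [flip true]. *)

Set Implicit Arguments.
Unset Strict Implicit.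
Unset Printing Implicit Defensive.

Local Open Scope classical_set_scope.

(** Each section, preimage and image of the box is either empty or one of its two factors. *)
Lemma interior_relation_box (X : topologicalType) (A B : set X) :
  clopen A -> clopen B -> interior_relation (A `*` B).
Proof.
move=> clA clB; split; [split=> [x|U clU]|move=> U clU].
- have [Ax|nAx] := pselect (A x).
    suff -> : rel_at (A `*` B) x = B by case: clB.
    by apply/seteqP; split=> y; [case|split].
  suff -> : rel_at (A `*` B) x = set0 by exact: closed0.
  by apply/seteqP; split=> y // [].
- have [[y [By Uy]]|nBU] := pselect (B `&` U !=set0).
    suff -> : rel_preimage (A `*` B) U = A by [].
    by apply/seteqP; split=> x; [case=> z _ []|exists y].
  suff -> : rel_preimage (A `*` B) U = set0 by exact: clopen0.
  by apply/seteqP; split=> x // [y Uy [_ By]]; apply: nBU; exists y.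
- have [[x [Ax Ux]]|nAU] := pselect (A `&` U !=set0).
    suff -> : rel_image (A `*` B) U = B by [].
    by apply/seteqP; split=> y; [case=> z _ []|exists x].
  suff -> : rel_image (A `*` B) U = set0 by exact: clopen0.
  by apply/seteqP; split=> y // [x Ux [Ax _]]; apply: nAU; exists x.
Qed.

Lemma interior_relationU (X : topologicalType) (R S : set (X * X)) :
  interior_relation R -> interior_relation S -> interior_relation (R `|` S).
Proof.
move=> [[Rat Rpre] Rim] [[Sat Spre] Sim].
split; [split=> [x|U clU]|move=> U clU].
- exact: closedU (Rat x) (Sat x).
- suff -> : rel_preimage (R `|` S) U = rel_preimage R U `|` rel_preimage S U.
    by apply: clopenU; [exact: Rpre|exact: Spre].
  apply/seteqP; split=> x.
    by case=> y Uy [|]; [left|right]; exists y.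
  by case=> [] [y Uy xy]; exists y => //; [left|right].
- suff -> : rel_image (R `|` S) U = rel_image R U `|` rel_image S U.
    by apply: clopenU; [exact: Rim|exact: Sim].
  apply/seteqP; split=> y.
    by case=> x Ux [|]; [left|right]; exists x.
  by case=> [] [x Ux xy]; exists x => //; [left|right].
Qed.

Lemma interior_relation_involution (X : topologicalType) (f : X -> X) :
  hausdorff_space X -> continuous f -> involutive f ->
  interior_relation [set p : X * X | p.2 = f p.1].
Proof.
move=> hX cf fK; split; [split=> [x|U clU]|move=> U clU].
- exact: accessible_closed_set1 (hausdorff_accessible hX) (f x).
- suff -> : rel_preimage [set p : X * X | p.2 = f p.1] U = f @^-1` U.
    exact: preimage_clopen.
  apply/seteqP; split=> x /=; first by case=> y Uy /= <-.
  by exists (f x).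
- suff -> : rel_image [set p : X * X | p.2 = f p.1] U = f @^-1` U.
    exact: preimage_clopen.
  apply/seteqP; split=> y /=; first by case=> x Ux /= ->; rewrite fK.
  by exists (f y) => //=; rewrite fK.
Qed.

Definition mkIR (X : topologicalType) (R : set (X * X))
  (hR : interior_relation R) : IR X := exist _ R (mem_set hR).

Lemma valIR (X : topologicalType) (R : IR X) : interior_relation (val R).
Proof. exact: set_mem (valP R). Qed.

Definition joinIR (X : topologicalType) (R S : IR X) : IR X :=
  mkIR (interior_relationU (valIR R) (valIR S)).

Lemma is_join_joinIR (X : topologicalType) (R S : IR X) :
  is_join R S (joinIR R S).
Proof.
split; first by move=> T [] ->; rewrite leIR => p; [left|right].
move=> T ubT; have := ubT S (or_intror erefl); have := ubT R (or_introl erefl).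
by rewrite !leIR => RT ST p [/RT|/ST].
Qed.

Lemma bounded_join_semilattice_IR (X : topologicalType) :
  bounded_join_semilattice (IR X).
Proof.
split; last by move=> R S; exists (joinIR R S); exact: is_join_joinIR.
- exists (mkIR (interior_relation_box (@clopen0 X) (@clopen0 X))) => R.
  by rewrite leIR => p [].
- exists (mkIR (interior_relation_box (@clopenT X) (@clopenT X))) => R.
  by rewrite leIR => p.
Qed.

(** Separation of points by clopen sets gives the Hausdorff property; compactness then turns it into
    a clopen basis. *)
Lemma stone_space_zero_dimensional (X : topologicalType) :
  compact [set: X] -> zero_dimensional X -> stone_space X.
Proof.
move=> cX zX.
have hX : hausdorff_space X.
  rewrite open_hausdorff => x y /zX[U [[oU cU] Ux nUy]].
  exists (U, ~` U); first by split; apply/mem_set.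
  by split; [|exact: closed_openC|rewrite setICr].
split=> //; split=> [U []//|x] /= U /(zero_dimensional_cvg hX zX cX).
by case=> V [Vx clV] VU; exists V.
Qed.

Section CompactifiedDiscrete.
Variable D : discreteTopologicalType.
Local Notation opc := (one_point_compactification D).

Lemma clopen_opc_some (a : D) : clopen [set (Some a : opc)].
Proof.
split.
  rewrite -image_set1; apply: one_point_compactification_open_some.
  exact: discrete_open.
rewrite -openC openE => -[x|] /= xa.
  apply: filterS (discrete_set1 x) => y /= ->; exact: xa.
(* Neighbourhoods of infinity contain the complement of a closed compact set, here [[set a]]. *)
exists [set a]; first by split; [exact: compact_set1|exact: discrete_closed].
by move=> _ [[y ya <-]|->] //= [].
Qed.

Lemma stone_space_opc : stone_space opc.
Proof.
apply: stone_space_zero_dimensional.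
  exact: one_point_compactification_compact.
move=> [x|] [y|] // /eqP xy.
- exists [set (Some x : opc)]; split=> //; first exact: clopen_opc_some.
  exact: nesym xy.
- by exists [set (Some x : opc)]; split=> //; exact: clopen_opc_some.
- exists (~` [set (Some y : opc)]); split=> //; last by apply.
  exact: clopenC set0 (clopen_opc_some y).
Qed.

(** Only infinity needs care: if [C] is compact, so is [g @]
    C[, and the involution]g[sends the complement of]g @[C] into that of [C]. *)
Lemma continuous_opc_omap (g : D -> D) :
  involutive g -> continuous (omap g : opc -> opc).
Proof.
move=> gK [x|] A.
  rewrite /= => nA; apply: filterS (discrete_set1 x) => y /= ->.
  exact: nbhs_singleton nA.
case=> C [cC _] CA; exists (g @` C).
  split; last exact: discrete_closed.
  apply: continuous_compact cC; apply: continuous_subspaceT => x U Ux.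
  apply: filterS (discrete_set1 x) => y /= ->; exact: nbhs_singleton Ux.
move=> _ [[y ngCy <-]|->]; apply: CA; last by right.
by left; exists (g y) => // Cgy; apply: ngCy; exists (g y).
Qed.

End CompactifiedDiscrete.

Section Counterexample.
Let D := discrete_topology (bool * bool * nat)%type.
Let X := one_point_compactification D.

(** Otherwise a compact set of isolated points would contain the whole sequence [(b, j, n)], which
    has no cluster point. *)
Lemma nbhs_infty_opc (U : set X) (b j : bool) :
  nbhs (None : X) U -> exists n, U (Some (b, j, n)).
Proof.
case=> C [cC _] CU; apply: contrapT => nU.
have CP n : C (b, j, n).
  by apply: contrapT => nC; apply: nU; exists n; apply: CU; left; exists (b, j, n).
pose s n : D := (b, j, n).
have sC : (s @ \oo) C by exists 0 => // n _; apply: CP.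
have [[[b' j'] m] [_ clm]] := cC (s @ \oo) _ sC.
(* The tail of [s] beyond index [m] misses the open singleton of the supposed cluster point. *)
have [||_ [[n /= mn <-] [_ _ nm]]] := clm (s @` [set n | m < n]) [set (b', j', m)].
- by exists m.+1 => // n /= mn; exists n.
- exact: (@discrete_set1 D).
- by rewrite nm ltnn in mn.
Qed.

Definition flip (b : bool) (x : D) : D :=
  let: (i, j, n) := x in (i, j (+) (i == b), n).

Lemma flipK b : involutive (flip b).
Proof. by move=> [[i j] n]; rewrite /flip -addbA addbb addbF. Qed.

Let hX : hausdorff_space X.
Proof. by have [] := stone_space_opc D. Qed.

Let graph_flip b : IR X := mkIR (interior_relation_involution hX
  (continuous_opc_omap (@flipK b)) (omapK (@flipK b))).

Let diag : IR X := mkIR (interior_relation_involution hX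
  (fun x => @cvg_id _ (nbhs x)) (fun x => erefl)).

Let dom (R : IR X) : set X := rel_preimage (val R) setT.

Let clopen_dom R : clopen (dom R).
Proof. by have [[_ Rpre] _] := valIR R; exact/Rpre/clopenT. Qed.

Lemma dom_sub_diag_flip (R : IR X) b :
  (R <= diag)%O -> (R <= graph_flip b)%O -> ~ dom R None.
Proof.
rewrite !leIR => Rdiag Rflip RN.
have /(nbhs_infty_opc b true)[n [y _ Ry]] : nbhs (None : X) (dom R).
  by apply: open_nbhs_nbhs; split=> //; case: (clopen_dom R).
have /= := Rflip _ Ry; have /= -> := Rdiag _ Ry.
by move=> [] /esym; rewrite eqxx.
Qed.

Lemma not_join_distributive : ~ join_distributive (IR X).
Proof.
move=> /(_ diag _ _ _ (is_join_joinIR (graph_flip true) (graph_flip false))).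
case.
  rewrite leIR => -[x y] /= ->.
  (* Points with first coordinate [true] are fixed by [flip false], all others by [flip true]. *)
  by case: x => [[[[] j] n]|]; [right|left|left] => //=; rewrite addbF.
move=> R [S [Rt Sf [ub lub]]].
have Rd := ub R (or_introl erefl); have Sd := ub S (or_intror erefl).
have [joinub _] := is_join_joinIR R S.
(* Since [diag] is a least upper bound of [R] and [S], it lies inside their union. *)
have := lub _ joinub; rewrite leIR => /(_ (None, None) erefl) [RN|SN].
- by apply: (dom_sub_diag_flip Rd Rt); exists None.
- by apply: (dom_sub_diag_flip Sd Sf); exists None.
Qed.

Lemma not_is_lattice : ~ is_lattice (IR X).
Proof.
move=> [_ /(_ diag (graph_flip true))[M [lb glb]]].
have nMN : ~ dom M None.
  by apply: dom_sub_diag_flip; apply: lb; [left|right].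
have /(nbhs_infty_opc false true)[n] : nbhs (None : X) (~` dom M).
  apply: open_nbhs_nbhs; split=> //; apply: closed_openC.
  by case: (clopen_dom M).
pose p : X := Some (false, true, n); apply.
have clp := @clopen_opc_some D (false, true, n).
(* As [flip true] fixes [p], the one-pair relation at [p] is a common lower bound, which puts [p] in
   [dom M]. *)
suff : (mkIR (interior_relation_box clp clp) <= M)%O.
  by rewrite leIR => /(_ (p, p)) Mp; exists p => //; apply: Mp.
by apply: glb => _ [] ->; rewrite leIR => -[x y] [/= -> ->].
Qed.

End Counterexample.

Theorem proposition4p6 :
  (forall X : topologicalType,
     stone_space X -> bounded_join_semilattice (IR X)) /\
  (exists X : topologicalType,
     [/\ stone_space X, ~ join_distributive (IR X) & ~ is_lattice (IR X)]).
Proof.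
split=> [X _|]; first exact: bounded_join_semilattice_IR.
exists (one_point_compactification (discrete_topology (bool * bool * nat)%type)).
split; first exact: stone_space_opc.
- exact: not_join_distributive.
- exact: not_is_lattice.
Qed.
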